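(* For every integer $n \geq 2$, there exists a graph $G$ such that both $G$ and $\overline{G}$ are connected and $h(G\overline{G}) = n$.
   Context: All graphs are finite, simple and undirected. For a graph $H$ and $x,y \in V(H)$, the closed interval $I[x,y]$ consists of $x$, $y$ and all vertices lying on some shortest path between $x$ and $y$ in $H$; for $S \subseteq V(H)$, $I[S] = \bigcup_{x,y\in S} I[x,y]$. A set $S$ is (geodetically) convex if $I[S]=S$; the convex hull $H(S)$ is the smallest convex set containing $S$; $S$ is a hull set if $H(S)=V(H)$; the (geodetic) hull number $h(H)$ is the minimum cardinality of a hull set of $H$. For a graph $G$ with vertex set $\{v_1,\dots,v_n\}$, the complementary prism $G\overline{G}$ has vertex set $\{v_1,\dots,v_n\}\cup\{\overline{v}_1,\dots,\overline{v}_n\}$ and edge set $E(G) \cup \{\overline{v}_i\overline{v}_j : i<j,\ v_iv_j\notin E(G)\} \cup \{v_i\overline{v}_i : 1\le i\le n\}$. *)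

(* Defs.v *)
From HB Require Import structures.
From mathcomp Require Import all_boot.

Set Implicit Arguments.
Unset Strict Implicit.
Unset Printing Implicit Defensive.

Record sgraph := SGraph {
  vertex :> finType;
  edge : rel vertex;
  edge_sym : symmetric edge;
  edge_irr : irreflexive edge }.

Arguments edge {G} : rename.

Section Complement.
Variable G : sgraph.

Definition compl_edge : rel G := [rel x y | (x != y) && ~~ edge x y].

Lemma compl_edge_sym : symmetric compl_edge.
Proof. by move=> x y; rewrite /compl_edge /= eq_sym edge_sym. Qed.

Lemma compl_edge_irr : irreflexive compl_edge.
Proof. by move=> x; rewrite /compl_edge /= eqxx. Qed.

Definition compl : sgraph := SGraph compl_edge_sym compl_edge_irr.

(* [inl v] is the copy of v in G and [inr v] is its copy in the complement. *)
Definition cprism_edge : rel (G + G)%type := fun a b =>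
  match a, b with
  | inl x, inl y => edge x y
  | inr x, inr y => compl_edge x y
  | inl x, inr y | inr x, inl y => x == y
  end.

Lemma cprism_edge_sym : symmetric cprism_edge.
Proof.
move=> [x|x] [y|y] /=; [exact: edge_sym | exact: eq_sym | exact: eq_sym |].
exact: compl_edge_sym.
Qed.

Lemma cprism_edge_irr : irreflexive cprism_edge.
Proof. by move=> [x|x]; [exact: edge_irr | exact: compl_edge_irr]. Qed.

Definition cprism : sgraph := SGraph cprism_edge_sym cprism_edge_irr.

End Complement.

Section Geodetic.
Variable G : sgraph.
Implicit Types (x y z : G) (p q : seq G) (S C : {set G}).

Definition connected : Prop :=
  0 < #|G| /\ forall x y, connect edge x y.

(* The path with vertex sequence x :: p. *)
Definition is_path x y p : bool :=
  [&& path edge x p, last x p == y & uniq (x :: p)].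

Definition shortest_path x y p : bool :=
  is_path x y p &&
  [forall k : 'I_(size p), forall q : k.-tuple G, ~~ is_path x y q].

(* Bounding the length by #|G| loses nothing, as paths do not repeat vertices;
   see [intervalP]. *)
Definition interval x y : {set G} :=
  [set z | [|| z == x, z == y |
    [exists k : 'I_#|G|, exists p : k.-tuple G,
      shortest_path x y p && (z \in x :: p)]]].

Definition interval_set S : {set G} :=
  \bigcup_(x in S) \bigcup_(y in S) interval x y.

Definition convex S : bool := interval_set S == S.

Definition hull S : {set G} :=
  \bigcap_(C : {set G} | convex C && (S \subset C)) C.

Definition hull_set S : bool := hull S == [set: G].

Definition hull_number : nat :=
  #|[arg min_(S < [set: G] | hull_set S) #|S| ]|.

Lemma shortest_pathP x y p :
  reflect (is_path x y p /\ forall q, is_path x y q -> size p <= size q)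
          (shortest_path x y p).
Proof.
apply: (iffP andP) => -[pxy min_p]; split=> //.
  move=> q qxy; rewrite leqNgt; apply/negP => lt_qp.
  move/forallP/(_ (Ordinal lt_qp))/forallP/(_ (in_tuple q)): min_p.
  by rewrite qxy.
apply/forallP=> k; apply/forallP=> q; apply/negP => /min_p.
by rewrite size_tuple leqNgt ltn_ord.
Qed.

Lemma intervalP x y z :
  reflect [\/ z = x, z = y | exists2 p, shortest_path x y p & z \in x :: p]
          (z \in interval x y).
Proof.
rewrite inE; apply: (iffP or3P) => -[].
- by move/eqP; constructor 1.
- by move/eqP; constructor 2.
- by case/existsP=> k /existsP[p /andP[sp zp]]; constructor 3; exists p.
- by move/eqP; constructor 1.
- by move/eqP; constructor 2.
case=> p sp zp; constructor 3.
have lt_p : size p < #|G|.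
  case/andP: sp => /and3P[_ _ /card_uniqP /= <-] _; exact: max_card.
apply/existsP; exists (Ordinal lt_p); apply/existsP; exists (in_tuple p).
by rewrite sp.
Qed.

Lemma interval_sub S : S \subset interval_set S.
Proof.
apply/subsetP=> x xS; apply/bigcupP; exists x => //; apply/bigcupP.
by exists x => //; apply/intervalP; constructor 1.
Qed.

Lemma convexT : convex [set: G].
Proof. by rewrite /convex eqEsubset subsetT interval_sub. Qed.

Lemma sub_hull S : S \subset hull S.
Proof. by apply/bigcapsP=> C /andP[]. Qed.

Lemma hull_min S C : convex C -> S \subset C -> hull S \subset C.
Proof. by move=> cC sSC; apply: bigcap_inf; rewrite cC. Qed.

Lemma convex_hull S : convex (hull S).
Proof.
rewrite /convex eqEsubset interval_sub andbT.
apply/bigcapsP=> C /andP[cC sSC]; rewrite -(eqP cC).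
have /subsetP sHC := hull_min cC sSC.
apply/subsetP=> z /bigcupP[x /sHC xC /bigcupP[y /sHC yC zxy]].
by apply/bigcupP; exists x => //; apply/bigcupP; exists y.
Qed.

Lemma hull_setT : hull_set [set: G].
Proof. by rewrite /hull_set eqEsubset subsetT sub_hull. Qed.

Lemma hull_numberP n :
  hull_number = n <->
  (exists2 S, hull_set S & #|S| = n) /\ (forall S, hull_set S -> n <= #|S|).
Proof.
rewrite /hull_number; case: arg_minnP => [|S hS minS]; first exact: hull_setT.
split=> [<- | [[S' hS' <-] min']]; first by split=> //; exists S.
by apply/eqP; rewrite eqn_leq minS ?min'.
Qed.

End Geodetic.

(* Main.v *)
Require Import Defs.
From mathcomp Require Import all_boot.

(** For [n = m + 2], let [G] be the clique on [bool + 'I_m] with a pendant vertex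
    attached to each of its two vertices in [bool]; for [m = 0] this is the path
    on four vertices. For a clique vertex [k], remove from the complementary prism
    both copies of [k] and, if [k] carries a pendant vertex, the copy of that
    vertex in [G]: what is left is convex. These [m + 2] removed sets are
    pairwise disjoint and each of them meets every hull set. Conversely the two
    pendant vertices together with the [m] other clique vertices, all taken in
    [G], form a hull set. *)

Set Implicit Arguments.
Unset Strict Implicit.
Unset Printing Implicit Defensive.

Lemma connected_hub (H : sgraph) (c : H) :
  (forall x, connect edge x c) -> connected H.
Proof.
move=> hub; split=> [|x y]; first by apply/card_gt0P; exists c.
apply: connect_trans (hub x) _.
by rewrite (sym_connect_sym (@edge_sym H)).
Qed.

(** * Convexity through shortcuts, and geodesics of length two and three *)

Section Convexity.
Variable G : sgraph.
Implicit Types (x y z : G) (p q : seq G) (C : {set G}).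

Lemma convexP C :
  reflect (forall x y p z, x \in C -> y \in C -> shortest_path x y p ->
             z \in x :: p -> z \in C)
          (convex C).
Proof.
apply: (iffP eqP) => [cC x y p z xC yC sp zp | cC].
  rewrite -cC; apply/bigcupP; exists x => //; apply/bigcupP; exists y => //.
  by apply/intervalP; constructor 3; exists p.
apply/eqP; rewrite eqEsubset interval_sub andbT; apply/subsetP => z.
case/bigcupP=> x xC /bigcupP[y yC /intervalP[-> | -> | [p sp zp]]] //.
exact: cC sp zp.
Qed.

(** An excursion outside [C] with vertex sequence [p] uses [size p + 1] edges, so a replacement with
    at most [size p] edges is strictly shorter. The replacement may itself leave [C]. *)
Lemma walk_bypass C :
  (forall u v p, u \in C -> v \in C -> 0 < size p -> all [predC C] p ->
     path edge u (rcons p v) ->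
     exists q, [/\ path edge u q, last u q = v & size q <= size p]) ->
  forall x p, x \in C -> last x p \in C -> path edge x p ->
    has [predC C] p ->
    exists q, [/\ path edge x q, last x q = last x p & size q < size p].
Proof.
move=> bypass x p; elim: p x => //= h t IH x xC lC /andP[xh ht].
case: (boolP (h \in C)) => /= hC.
  case/(IH _ hC lC ht) => q [pq lq sq]; exists (h :: q) => /=.
  by rewrite xh pq lq.
(* The walk leaves [C] at once; it is cut at its first return [v] to [C], and the excursion up to
   there is replaced. *)
move=> _; have hast : has (mem C) t.
  by apply/hasP; exists (last h t) => //; move: (mem_last h t) lC;
     rewrite inE => /predU1P[->|//]; rewrite (negPf hC).
case/split_find: hast ht lC => v t1 t2 vC nt1.
rewrite cat_path last_cat last_rcons => /andP[p1 p2] lC.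
have at1 : all [predC C] (h :: t1) by rewrite /= hC; rewrite -all_predC in nt1.
have [//||q [pq lq sq]] := bypass x v (h :: t1) xC vC _ at1.
  by rewrite /= xh.
exists (q ++ t2); rewrite cat_path pq lq p2 last_cat lq; split=> //.
by rewrite /= !size_cat size_rcons ltnS leq_add2r.
Qed.

Lemma convex_bypass C :
  (forall u v p, u \in C -> v \in C -> 0 < size p -> all [predC C] p ->
     path edge u (rcons p v) ->
     exists q, [/\ path edge u q, last u q = v & size q <= size p]) ->
  convex C.
Proof.
move=> bypass; apply/convexP => x y p z xC yC.
case/shortest_pathP=> /and3P[pp /eqP lp _] min_p zp.
apply/negPn/negP=> zC; have hp : has [predC C] p.
  apply/hasP; exists z => //; move: zp; rewrite inE => /predU1P[zx|//].
  by rewrite zx xC in zC.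
rewrite -lp in yC; have [q [pq lq]] := walk_bypass bypass xC yC pp hp.
rewrite ltnNge => /negP[].
case: (shortenP pq) lq => q' pq' uq' sub_q' lq'.
have /min_p le_pq' : is_path x y q' by rewrite /is_path pq' uq' lq' lp eqxx.
apply: leq_trans le_pq' _; case/andP: uq' => _ uq'.
exact: uniq_leq_size.
Qed.

Lemma convex_dist2 C x z y : convex C -> x \in C -> y \in C ->
  edge x z -> edge z y -> x != y -> ~~ edge x y -> z \in C.
Proof.
move=> /convexP cC xC yC xz zy nxy exy.
apply: (cC x y [:: z; y]) => //; last by rewrite !inE eqxx orbT.
apply/shortest_pathP; split.
  rewrite /is_path /= xz zy eqxx !inE negb_or nxy !andbT /=.
  by apply/andP; split; apply: contraTneq isT => e; move: xz zy;
     rewrite e ?edge_irr // -e edge_irr.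
case=> [|t [|//]] /and3P[] /=; first by rewrite (negPf nxy).
by rewrite andbT => xt /eqP ty; rewrite -ty xt in exy.
Qed.

(** [far] excludes a common neighbour of [x] and [y], so the three given edges form a geodesic. *)
Lemma convex_dist3 C x z t y : convex C -> x \in C -> y \in C ->
  edge x z -> edge z t -> edge t y -> x != y -> ~~ edge x y ->
  (forall w, edge x w -> ~~ edge w y) -> z \in C.
Proof.
move=> /convexP cC xC yC xz zt ty nxy exy far.
apply: (cC x y [:: z; t; y]) => //; last by rewrite !inE eqxx orbT.
apply/shortest_pathP; split.
  have irr a b : edge a b -> (a == b) = false.
    by apply: contraTF => /eqP ->; rewrite edge_irr.
  have xt : (x == t) = false.
    by apply: contraNF exy => /eqP ->.
  have zy : (z == y) = false.
    by apply: contraNF exy => /eqP <-.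
  by rewrite /is_path /= !inE xz zt ty eqxx (negPf nxy) xt zy !irr.
case=> [|a [|b [|//]]] /and3P[] /=; first by rewrite (negPf nxy).
  by rewrite andbT => xa /eqP ay; rewrite -ay xa in exy.
rewrite andbT => /andP[/far nay ab] /eqP yb.
by rewrite -yb ab in nay.
Qed.

End Convexity.

(** * Diameter and convex sets of a complementary prism *)

Section Prism.
Variable G : sgraph.

(** Distinct [x] and [y] are adjacent in exactly one of the two copies; at most two matching edges
    lead to that copy and back. *)
Lemma cprism_diameter (u v : cprism G) :
  exists q, [/\ path edge u q, last u q = v & size q <= 3].
Proof.
case: u v => [x|x] [y|y].
- have [<-|nxy] := eqVneq x y; first by exists [::].
  case exy : (edge x y); first by exists [:: inl y]; rewrite /= exy.
  by exists [:: inr x; inr y; inl y]; rewrite /= /compl_edge /= !eqxx nxy exy.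
- have [<-|nxy] := eqVneq x y; first by exists [:: inr x]; rewrite /= eqxx.
  case exy : (edge x y); first by exists [:: inl y; inr y]; rewrite /= exy eqxx.
  by exists [:: inr x; inr y]; rewrite /= /compl_edge /= eqxx nxy exy.
- have [<-|nxy] := eqVneq x y; first by exists [:: inl x]; rewrite /= eqxx.
  case exy : (edge x y); first by exists [:: inl x; inl y]; rewrite /= exy eqxx.
  by exists [:: inr y; inl y]; rewrite /= /compl_edge /= eqxx nxy exy.
have [<-|nxy] := eqVneq x y; first by exists [::].
case exy : (edge x y); last by exists [:: inr y]; rewrite /= /compl_edge /= nxy exy.
by exists [:: inl x; inl y; inr y]; rewrite /= exy !eqxx.
Qed.

(** Since any two vertices are at distance at most 3, excursions with three or more outside vertices
    always have a bypass; only those with one or two need checking. *)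
Lemma cprism_convex (C : {set cprism G}) :
  (forall u w v, u \in C -> v \in C -> w \notin C -> edge u w -> edge w v ->
     u = v \/ edge u v) ->
  (forall u w w' v, u \in C -> v \in C -> w \notin C -> w' \notin C ->
     edge u w -> edge w w' -> edge w' v ->
     [\/ u = v, edge u v | exists2 t, edge u t & edge t v]) ->
  convex C.
Proof.
move=> c1 c2; apply: convex_bypass => u v [|w [|w' [|w'' p]]] //= uC vC _.
- rewrite !andbT => wC /andP[uw wv].
  case: (c1 u w v) => // [->|uv]; first by exists [::].
  by exists [:: v]; split; rewrite //= andbT.
- rewrite !andbT => /andP[wC w'C] /and3P[uw ww' w'v].
  case: (c2 u w w' v) => // [->|uv|[t ut tv]]; first by exists [::].
    by exists [:: v]; split; rewrite //= andbT.
  by exists [:: t; v]; split; rewrite //= andbT; apply/andP.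
move=> _ _; have [q [pq lq sq]] := cprism_diameter u v.
by exists q; split=> //; apply: leq_trans sq _.
Qed.

End Prism.

(** * The clique with two pendant vertices *)

Section Construction.
Variable m : nat.

(* [inl k] is a clique vertex and [inr s] the pendant vertex at [inl (inl s)]. *)
Definition pendant_vertex : finType := ((bool + 'I_m) + bool)%type.

Definition pendant_edge : rel pendant_vertex := fun a b =>
  match a, b with
  | inl k, inl l => k != l
  | inl k, inr s | inr s, inl k => k == inl s
  | inr _, inr _ => false
  end.

Lemma pendant_edge_sym : symmetric pendant_edge.
Proof. by move=> [k|s] [l|t] //=; rewrite eq_sym. Qed.

Lemma pendant_edge_irr : irreflexive pendant_edge.
Proof. by move=> [k|s] //=; rewrite eqxx. Qed.

Definition pendant_clique : sgraph :=
  SGraph pendant_edge_sym pendant_edge_irr.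

Local Notation G := pendant_clique.
Local Notation P := (cprism pendant_clique).

Lemma pendant_clique_connected : connected G.
Proof.
apply: (@connected_hub G (inl (inl true))).
have clique k : connect (@edge G) (inl k) (inl (inl true)).
  by have [->|nk] := eqVneq k (inl true); [exact: connect0 | exact: connect1].
case=> [k|s]; first exact: clique.
by apply: connect_trans (clique (inl s)); apply: connect1; rewrite /= eqxx.
Qed.

Lemma pendant_clique_compl_connected : connected (compl G).
Proof.
apply: (@connected_hub (compl G) (inr true)).
have pend s : connect (@edge (compl G)) (inr s) (inr true).
  by case: s; [exact: connect0 | exact: connect1].
case=> [[s|i]|s]; last exact: pend.
  apply: connect_trans (pend (~~ s)); apply: connect1.
  by case: s.
exact: connect1.
Qed.

Definition prism_label (v : P) : bool + 'I_m :=
  match v with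
  | inl (inl k) | inr (inl k) => k
  | inl (inr s) | inr (inr s) => inl s
  end.

Definition compl_pendant (v : P) : bool :=
  if v is inr (inr _) then true else false.

(** The vertex [inr (inr s)] must stay when [k = inl s]: it is a common neighbour of
    [inr (inl (inl (~~ s)))] and [inr (inr (~~ s))], which are not adjacent. *)
Definition avoid (k : bool + 'I_m) : {set P} :=
  [set v | (prism_label v != k) || compl_pendant v].

Lemma avoid_boundary k u w : u \in avoid k -> w \notin avoid k -> edge u w ->
  (exists l, u = inl (inl l) /\ w = inl (inl k)) \/
  (exists t, u = inr (inr t) /\ w != inl (inl k)).
Proof.
rewrite !inE negb_or negbK.
case: u w => [[l|t]|[l|t]] [[j|s]|[j|s]] /=; rewrite ?andbF //.
all: rewrite ?orbF ?andbT /compl_edge /= => uk /eqP ejk.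
all: try by right; exists t.
- by left; exists l; rewrite ejk.
- by rewrite ejk (negPf uk).
- by case/eqP=> lj; rewrite lj ejk eqxx in uk.
- by rewrite ejk eq_sym (negPf uk).
- by case/eqP=> lj; rewrite lj ejk eqxx in uk.
by rewrite negbK => /andP[_ /eqP lj]; rewrite lj ejk eqxx in uk.
Qed.

(** Boundary vertices are of two kinds, each pairwise adjacent. By [avoid_boundary], no single
    outside vertex is adjacent to both kinds, so an excursion between kinds has at least three edges
    and a common neighbour gives a bypass. *)
Lemma avoid_convex k : convex (avoid k).
Proof.
have inner (l j : bool + 'I_m) :
    inl (inl l) = inl (inl j) :> P \/ @edge P (inl (inl l)) (inl (inl j)).
  by have [->|] := eqVneq l j; [left | right].
have outer (s t : bool) :
    inr (inr s) = inr (inr t) :> P \/ @edge P (inr (inr s)) (inr (inr t)).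
  by case: s t => [] []; [left | right | right | left].
have mixed (l : bool + 'I_m) (t : bool) :
    exists2 z : P, @edge P (inl (inl l)) z & @edge P z (inr (inr t)).
  have [->|nlt] := eqVneq l (inl t).
    by exists (inl (inr t)); rewrite /= eqxx.
  by exists (inr (inl l)); rewrite /= ?eqxx ?nlt.
apply: cprism_convex => [u w v uC vC wC uw wv | u w w' v uC vC wC w'C uw _ w'v].
  rewrite edge_sym in wv.
  case: (avoid_boundary uC wC uw) => [[l [-> ew]]|[t [-> nw]]];
  case: (avoid_boundary vC wC wv) => [[l' [-> ew']]|[t' [-> nw']]] //.
    by rewrite ew eqxx in nw'.
  by rewrite ew' eqxx in nw.
rewrite edge_sym in w'v.
case: (avoid_boundary uC wC uw) => [[l [-> _]]|[t [-> _]]];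
case: (avoid_boundary vC w'C w'v) => [[l' [-> _]]|[t' [-> _]]].
- by case: (inner l l'); [constructor 1 | constructor 2].
- by constructor 3; apply: mixed.
- constructor 3; have [z lz zt] := mixed l' t.
  by exists z; rewrite edge_sym.
by case: (outer t t'); [constructor 1 | constructor 2].
Qed.

Definition hull_vertex (k : bool + 'I_m) : P :=
  match k with inl s => inl (inr s) | inr i => inl (inl (inr i)) end.

Lemma hull_vertex_inj : injective hull_vertex.
Proof. by move=> [s|i] [t|j] //= [->]. Qed.

Lemma hull_vertex_hull_set : hull_set (hull_vertex @: setT).
Proof.
rewrite /hull_set eqEsubset subsetT; apply/bigcapsP => C /andP[cC /subsetP sC].
have pen s : inl (inr s) \in C by apply: sC; apply/imsetP; exists (inl s).
have cli i : inl (inl (inr i)) \in C.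
  by apply: sC; apply/imsetP; exists (inr i).
(* The pendant vertices are at distance 3: one geodesic runs through their complement copies,
   another, used for [inn], through their clique neighbours. *)
have cpen s : inr (inr s) \in C.
  apply: (@convex_dist3 _ C (inl (inr s)) _ (inr (inr (~~ s))) (inl (inr (~~ s)))) => //=.
  - by case: s.
  - by case: s.
  by case=> [[k|t]|[k|t]] //=; [move/eqP-> | move/eqP=> [<-]]; case: s.
have inn s : inl (inl (inl s)) \in C.
  apply: (@convex_dist3 _ C (inl (inr s)) _ (inl (inl (inl (~~ s)))) (inl (inr (~~ s)))) => //=.
  - by case: s.
  - by case: s.
  by case=> [[k|t]|[k|t]] //=; [move/eqP-> | move/eqP=> [<-]]; case: s.
have clis k : inl (inl k) \in C by case: k.
apply/subsetP => -[[k|s]|[k|s]] _ //.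
(* A pendant vertex not attached to [k] is adjacent to [k] in the complement, so [inr (inl k)] lies
   midway between [inl (inl k)] and [inr (inr t)]. *)
have [t nkt] : exists t, k != inl t.
  by case: k => [s|i]; [exists (~~ s); case: s | exists true].
by apply: (@convex_dist2 _ C (inl (inl k)) _ (inr (inr t))) => //=.
Qed.

(** If a label [k] were missing on [S], the hull of [S] would stay inside [avoid k], which omits
    [inl (inl k)]. So [prism_label] maps [S] onto all labels. *)
Lemma hull_set_card (S : {set P}) : hull_set S -> m.+2 <= #|S|.
Proof.
move=> /eqP hS; have -> : m.+2 = #|[set: (bool + 'I_m)%type]|.
  by rewrite cardsT card_sum card_bool card_ord.
apply: leq_trans (leq_imset_card prism_label S); apply: subset_leq_card.
apply/subsetP => k _; apply/negPn/negP => kS.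
have sS : S \subset avoid k.
  apply/subsetP => v vS; rewrite inE; apply/orP; left.
  by apply: contraNneq kS => <-; apply: imset_f.
have := hull_min (avoid_convex k) sS; rewrite hS => /subsetP/(_ (inl (inl k))).
by rewrite !inE eqxx => /(_ isT).
Qed.

Lemma hull_number_pendant_clique : hull_number P = m.+2.
Proof.
apply/hull_numberP; split; last exact: hull_set_card.
exists (hull_vertex @: setT); first exact: hull_vertex_hull_set.
by rewrite card_imset ?cardsT ?card_sum ?card_bool ?card_ord //; apply: hull_vertex_inj.
Qed.

End Construction.

Theorem theorem8 (n : nat) (hn : 2 <= n) :
  exists G : sgraph,
    [/\ connected G, connected (compl G) & hull_number (cprism G) = n].
Proof.
case: n hn => [|[|m]] // _; exists (pendant_clique m); split.
- exact: pendant_clique_connected.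
- exact: pendant_clique_compl_connected.
exact: hull_number_pendant_clique.
Qed.
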